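(* Let $0<\rho\le r\le R$ and let $\Omega\subseteq\mathbb{R}^n$ be a domain contained in the open ball $\mathbb{B}_R(0)$, containing the open ball $\mathbb{B}_r(0)$, and star-shaped with respect to the open ball $\mathbb{B}_\rho(0)$. Let $\mathbf{S}$ be the expansion transformation of $\Omega$. For all $x,y\in\mathbb{R}^n$ we have $$ c(\rho,r,R)\,\|x-y\|\le\|\mathbf{S}(x)-\mathbf{S}(y)\|\le C(\rho,R)\,\|x-y\|, $$ where $$ C(\rho,R):=\frac{R}{2\rho}\left(\sqrt{R^2+3\rho^2}+\sqrt{R^2-\rho^2}\right),\qquad c(\rho,r,R):=\min_{a\in[r,R]}\frac{a}{2\rho}\left(\sqrt{a^2+3\rho^2}-\sqrt{a^2-\rho^2}\right). $$ Furthermore, $$ c(\rho,r,R)= \begin{cases} \dfrac{r}{2\rho}\left(\sqrt{r^2+3\rho^2}-\sqrt{r^2-\rho^2}\right) & \text{if } \sqrt{\tfrac32}\,\rho\le r,\\[1ex] \dfrac{\sqrt3}{2}\,\rho & \text{if } r\le\sqrt{\tfrac32}\,\rho\le R,\\[1ex] \dfrac{R}{2\rho}\left(\sqrt{R^2+3\rho^2}-\sqrt{R^2-\rho^2}\right) & \text{if } R\le\sqrt{\tfrac32}\,\rho. \end{cases} $$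
   Context: A domain is an open connected set. $\mathbb{B}_t(0)$ is the open Euclidean ball of radius $t$ about the origin and $\|\cdot\|$ the Euclidean norm. $\Omega$ is star-shaped with respect to a subset $B\subseteq\Omega$ if for all $x\in\Omega$, $x_0\in B$, $\lambda\in[0,1]$ one has $(1-\lambda)x+\lambda x_0\in\Omega$. Expansion transformation: for unit vectors $\hat u$ put $s(\hat u):=\sup\{t>0: t\hat u\in\Omega\}$; then $\mathbf{S}:\mathbb{R}^n\to\mathbb{R}^n$, $\mathbf{S}(x):=s(x/\|x\|)\,x$ for $x\ne0$ and $\mathbf{S}(0):=0$. *)

(* Defs.v *)
From HB Require Import structures.
From mathcomp Require Import all_boot all_order all_algebra.
From mathcomp Require Import all_classical all_reals all_analysis.

Set Implicit Arguments.
Unset Strict Implicit.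
Unset Printing Implicit Defensive.

Import Order.TTheory GRing.Theory Num.Theory.
Import numFieldNormedType.Exports.

Local Open Scope classical_set_scope.
Local Open Scope ring_scope.

(* MathComp-Analysis equips 'rV[K]_n with the sup norm, hence the separate
   Euclidean norm and balls.  Both norms induce the same topology, so the
   library's [open] and [connected] on 'rV[K]_n are the usual notions. *)
Definition enorm (K : realType) (n : nat) (x : 'rV[K]_n) : K :=
  Num.sqrt (\sum_(i < n) x ord0 i ^+ 2).

Definition eball (K : realType) (n : nat) (t : K) : set 'rV[K]_n :=
  [set x | enorm x < t].

Definition is_domain (K : realType) (n : nat) (Omega : set 'rV[K]_n) : Prop :=
  open Omega /\ connected Omega.

Definition star_shaped (K : realType) (n : nat)
    (Omega B : set 'rV[K]_n) : Prop :=
  B `<=` Omega /\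
  forall (x x0 : 'rV[K]_n) (lambda : K),
    Omega x -> B x0 -> 0 <= lambda <= 1 ->
    Omega ((1 - lambda) *: x + lambda *: x0).

(* [sup] is only meaningful for nonempty bounded sets, as is the case for unit
   vectors u when Omega is bounded and contains a ball about 0. *)
Definition radial_sup (K : realType) (n : nat) (Omega : set 'rV[K]_n)
    (u : 'rV[K]_n) : K :=
  sup [set t : K | 0 < t /\ Omega (t *: u)].

Definition expansion (K : realType) (n : nat) (Omega : set 'rV[K]_n)
    (x : 'rV[K]_n) : 'rV[K]_n :=
  if x == 0 then 0 else radial_sup Omega ((enorm x)^-1 *: x) *: x.

Definition upper_const (K : realType) (rho R : K) : K :=
  R / (2 * rho) *
    (Num.sqrt (R ^+ 2 + 3 * rho ^+ 2) + Num.sqrt (R ^+ 2 - rho ^+ 2)).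

Definition lower_fun (K : realType) (rho a : K) : K :=
  a / (2 * rho) *
    (Num.sqrt (a ^+ 2 + 3 * rho ^+ 2) - Num.sqrt (a ^+ 2 - rho ^+ 2)).

(* The minimum of a real set is its infimum when attained; attainment is part
   of the conclusion of the theorem. *)
Definition lower_const (K : realType) (rho r R : K) : K :=
  inf [set lower_fun rho a | a in `[r, R]].

(* Main.v *)
Require Import Defs.
From HB Require Import structures.
From mathcomp Require Import all_boot all_order all_algebra.
From mathcomp Require Import all_classical all_reals all_analysis.
From mathcomp Require Import ring lra.

Set Implicit Arguments.
Unset Strict Implicit.
Unset Printing Implicit Defensive.

Import Order.TTheory GRing.Theory Num.Theory.
Import numFieldNormedType.Exports.
Local Open Scope classical_set_scope.
Local Open Scope ring_scope.

(** The expansion multiplies a vector of direction [u] by the radial function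
    [s u], the distance from the origin to the boundary of [Omega] along [u],
    and [r <= s u <= R].  Star-shapedness with respect to the ball of radius
    [rho] says that [Omega] contains the convex hull of that ball and of any
    of its points.  Hence the boundary cannot be steeper than a tangent line to
    the small ball: with [s u = rho / cos (phi u)], the function [phi] is
    1-Lipschitz for the angle between directions.  In algebraic form
    ([radial_dot]), for radii [a = s u] and [b = s v],
      [a * b * <u, v> <= rho ^+ 2 + sqrt (a ^+ 2 - rho ^+ 2)
                                    * sqrt (b ^+ 2 - rho ^+ 2)].

    Infinitesimally, the expansion acts in polar coordinates as [s] times a
    shear with entry at most [sqrt (s ^+ 2 - rho ^+ 2) / rho] in absolute
    value.  The extreme singular values of such a map are [upper_const rho s]
    and [lower_fun rho s], which explains the two constants.  Instead of
    integrating this local bound along paths, two points are compared directly.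
    For [x], [y] with directions [u], [v], the difference between
    [d ^+ 2 * |x - y| ^+ 2] and [|a x - b y| ^+ 2] is a quadratic form in the
    norms of [x] and [y] whose cross term is controlled by [radial_dot].  Its
    determinant has the right sign as soon as
      [a * b * d * (k + l) <= rho * |d ^+ 2 - a * b| * (a + b)],
    where [k] and [l] are the two square roots above ([det_distortion_ge]).
    Each constant solves a quadratic equation.  For the upper constant the
    condition then follows because [a] and [b] are at most [R]
    ([upper_pair]).  For the lower one it follows from the value of
    [lower_fun] at the geometric mean of [a] and [b], which again lies between
    [r] and [R] ([geom_mean_slope], [lower_pair]).

    The minimum of [lower_fun] comes from the identity
      [16 * rho ^+ 2 * lower_fun rho a ^+ 2
         = (w - 2 * rho ^+ 2) ^+ 2 + 12 * rho ^+ 4],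
    where [w], the squared gap between the two square roots in [lower_fun],
    decreases as [a] grows ([lower_fun_sqr], [sqrt_gap_anti]); the value
    [w = 2 * rho ^+ 2] is reached at [a = sqrt (3 / 2) * rho]. *)

(** * Euclidean norm and inner product *)

Definition dot (K : realType) (n : nat) (x y : 'rV[K]_n) : K :=
  \sum_(i < n) x ord0 i * y ord0 i.

Lemma enorm_ge0 (K : realType) (n : nat) (x : 'rV[K]_n) : 0 <= enorm x.
Proof. exact: sqrtr_ge0. Qed.

Lemma enorm_comb (K : realType) (n : nat) (x y : 'rV[K]_n) (p q : K) :
  enorm (p *: x + q *: y) ^+ 2 =
    p ^+ 2 * enorm x ^+ 2 + q ^+ 2 * enorm y ^+ 2 + 2 * (p * q) * dot x y.
Proof.
rewrite /enorm !sqr_sqrtr; try by apply: sumr_ge0 => i _; exact: sqr_ge0.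
rewrite /dot !mulr_sumr -!big_split; apply: eq_bigr => i _ /=.
rewrite !mxE; ring.
Qed.

Lemma dotC (K : realType) (n : nat) (x y : 'rV[K]_n) : dot x y = dot y x.
Proof. by apply: eq_bigr => i _; rewrite mulrC. Qed.

Lemma enorm0 (K : realType) (n : nat) : enorm (0 : 'rV[K]_n) = 0.
Proof.
by rewrite /enorm big1 ?sqrtr0 // => i _; rewrite mxE expr0n.
Qed.

Lemma enormZ (K : realType) (n : nat) (x : 'rV[K]_n) (p : K) :
  0 <= p -> enorm (p *: x) = p * enorm x.
Proof.
move=> p0; apply: (@pexpIrn _ 2%N) => //; rewrite ?nnegrE ?enorm_ge0 //.
  by rewrite mulr_ge0 ?enorm_ge0.
have := enorm_comb x 0 p 0.
by rewrite scaler0 addr0 enorm0 => ->; ring.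
Qed.

Lemma enormN (K : realType) (n : nat) (x : 'rV[K]_n) : enorm (- x) = enorm x.
Proof. by congr Num.sqrt; apply: eq_bigr => i _; rewrite mxE sqrrN. Qed.

Lemma enorm_gt0 (K : realType) (n : nat) (x : 'rV[K]_n) :
  x != 0 -> 0 < enorm x.
Proof.
move=> x0; rewrite lt_neqAle enorm_ge0 andbT eq_sym.
apply: contra x0 => /eqP /(congr1 (fun z => z ^+ 2)).
rewrite /enorm sqr_sqrtr ?sumr_ge0 // => [|i _]; last exact: sqr_ge0.
rewrite expr0n /= => /psumr_eq0P h.
apply/eqP/rowP => i; rewrite mxE; apply/eqP; rewrite -sqrf_eq0; apply/eqP.
by apply: h => // j _; exact: sqr_ge0.
Qed.

Lemma enorm_normalize (K : realType) (n : nat) (x : 'rV[K]_n) :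
  x != 0 -> enorm ((enorm x)^-1 *: x) = 1.
Proof.
move=> /enorm_gt0 x0.
by rewrite enormZ ?invr_ge0 ?enorm_ge0 // mulVf // gt_eqF.
Qed.

Lemma dot_unit_le1 (K : realType) (n : nat) (u v : 'rV[K]_n) :
  enorm u = 1 -> enorm v = 1 -> dot u v <= 1.
Proof.
move=> u1 v1; have := enorm_comb u v 1 (-1); rewrite u1 v1 => h.
have := sqr_ge0 (enorm (1 *: u + -1 *: v)); rewrite h; lra.
Qed.

(** * The radial function of a star-shaped set *)

(** If the point [p - mu *: q] had norm below [rho * (1 - mu)], then [p] would
    be a convex combination of [q] and a point of the small ball, hence a point
    of [Omega].  So a point outside [Omega] is outside the convex hull of the
    small ball and any point of [Omega]. *)
Lemma star_dist (K : realType) (n : nat) (Omega : set 'rV[K]_n) (rho mu : K)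
    (p q : 'rV[K]_n) :
  star_shaped Omega (eball rho) -> 0 < rho -> 0 <= mu < 1 ->
  Omega q -> ~ Omega p ->
  rho ^+ 2 * (1 - mu) ^+ 2 <= enorm (p - mu *: q) ^+ 2.
Proof.
move=> [_ star] rho0 /andP[mu0 mu1] Oq nOp; rewrite leNgt; apply/negP => lt.
apply: nOp.
have l0 : 0 < 1 - mu by rewrite subr_gt0.
have -> : p = (1 - (1 - mu)) *: q + (1 - mu) *: ((1 - mu)^-1 *: (p - mu *: q)).
  by rewrite scalerA mulfV ?gt_eqF // scale1r subKr addrC subrK.
apply: star => //; last by rewrite ltW //= lerBlDr lerDl.
rewrite /eball /= enormZ ?invr_ge0 ?(ltW l0) // mulrC ltr_pdivrMr //.
rewrite -(@ltr_pXn2r _ 2%N) ?nnegrE ?enorm_ge0 //; first by rewrite exprMn.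
by rewrite mulr_ge0 ?ltW.
Qed.

Section Radial.
Variables (K : realType) (n : nat) (rho r R : K) (Omega : set 'rV[K]_n).
Hypotheses (rho_gt0 : 0 < rho) (rho_le_r : rho <= r).
Hypotheses (Omega_sub : Omega `<=` eball R) (sub_Omega : eball r `<=` Omega).
Hypothesis Omega_star : star_shaped Omega (eball rho).
Implicit Types (u v : 'rV[K]_n) (t : K).

Lemma lt_radius u t :
  enorm u = 1 -> 0 < t -> Omega (t *: u) -> t < R.
Proof.
by move=> u1 t0 /Omega_sub; rewrite /eball /= enormZ ?ltW // u1 mulr1.
Qed.

Lemma ball_mem u t : enorm u = 1 -> 0 < t -> t < r -> Omega (t *: u).
Proof.
move=> u1 t0 tr; apply: sub_Omega.
by rewrite /eball /= enormZ ?ltW // u1 mulr1.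
Qed.

Lemma radial_has_sup u : enorm u = 1 ->
  has_sup [set t : K | 0 < t /\ Omega (t *: u)].
Proof.
move=> u1; have r0 : 0 < r by exact: lt_le_trans rho_le_r.
split; first by exists (r / 2); split; [lra | apply: ball_mem => //; lra].
by exists R => t [t0 Ot]; apply/ltW/(lt_radius u1).
Qed.

Lemma radial_mem u t :
  enorm u = 1 -> 0 < t -> t < radial_sup Omega u -> Omega (t *: u).
Proof.
move=> u1 t0 ts.
have e0 : 0 < radial_sup Omega u - t by rewrite subr_gt0.
have [z [z0 Oz] tz] := sup_adherent e0 (radial_has_sup u1).
rewrite -/(radial_sup Omega u) subKr in tz.
(* The origin belongs to the small ball, so Omega is star-shaped about it. *)
have [_ star] := Omega_star.
have := star (z *: u) 0 (1 - t / z) Oz.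
rewrite scaler0 addr0 scalerA subKr divfK ?gt_eqF //; apply.
  by rewrite /eball /= enorm0.
by rewrite subr_ge0 ler_pdivrMr // mul1r ltW //= lerBlDr lerDl divr_ge0 ?ltW.
Qed.

Lemma radial_notmem u t :
  enorm u = 1 -> 0 < t -> radial_sup Omega u < t -> ~ Omega (t *: u).
Proof.
move=> u1 t0 st Ot; have := sup_upper_bound (radial_has_sup u1).
by move=> /(_ t (conj t0 Ot)); rewrite leNgt st.
Qed.

Lemma radial_ge u : enorm u = 1 -> r <= radial_sup Omega u.
Proof.
move=> u1; rewrite leNgt; apply/negP => sr.
have s0 : 0 < radial_sup Omega u.
  have [[z [z0 Oz]] _] := radial_has_sup u1.
  exact: lt_le_trans z0 (sup_upper_bound (radial_has_sup u1) (conj z0 Oz)).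
pose t := (radial_sup Omega u + r) / 2.
have t0 : 0 < t by rewrite /t; lra.
apply: (radial_notmem u1 t0) => //; first by rewrite /t; lra.
by apply: ball_mem => //; rewrite /t; lra.
Qed.

Lemma radial_le u : enorm u = 1 -> radial_sup Omega u <= R.
Proof.
move=> u1; apply: ge_sup; first by case: (radial_has_sup u1).
by move=> t [t0 Ot]; apply/ltW/(lt_radius u1).
Qed.

(** The cone property of [star_dist], read at the boundary points
    [radial_sup Omega u *: u] and [radial_sup Omega v *: v].  They are
    approached by points of the first ray outside [Omega] and points of the
    second ray inside [Omega]. *)
Lemma radial_dist u v mu : enorm u = 1 -> enorm v = 1 -> 0 <= mu < 1 ->
  rho ^+ 2 * (1 - mu) ^+ 2 <=
    radial_sup Omega u ^+ 2 + mu ^+ 2 * radial_sup Omega v ^+ 2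
    - 2 * mu * (radial_sup Omega u * radial_sup Omega v * dot u v).
Proof.
move=> u1 v1 mu01.
have := radial_ge u1; have := radial_ge v1.
have := @radial_mem v; have := @radial_notmem u.
move: (radial_sup Omega u) (radial_sup Omega v) => a b nm mm rb ra.
have a0 : 0 < a by exact: lt_le_trans (lt_le_trans rho_gt0 rho_le_r) ra.
have b0 : 0 < b by exact: lt_le_trans (lt_le_trans rho_gt0 rho_le_r) rb.
set G := dot u v.
(* The point outside is (a / t) u and the point inside is (t b) v, with
   t < 1 tending to 1; multiplying by t ^+ 2 removes the denominator. *)
have key t : 0 < t -> t < 1 ->
  t ^+ 2 * (rho ^+ 2 * (1 - mu) ^+ 2 + 2 * mu * (a * b * G)
     - mu ^+ 2 * b ^+ 2) <= a ^+ 2.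
  move=> t0 t1.
  have at0 : 0 < a / t by rewrite divr_gt0.
  have tb : t * b < b by rewrite gtr_pMl.
  have at1 : a < a / t by rewrite ltr_pdivlMr // gtr_pMr.
  have := star_dist Omega_star rho_gt0 mu01
    (mm _ v1 (mulr_gt0 t0 b0) tb) (nm _ u1 at0 at1).
  rewrite scalerA -scaleNr enorm_comb u1 v1 -/G.
  have -> : (a / t) ^+ 2 * 1 ^+ 2 + (- (mu * (t * b))) ^+ 2 * 1 ^+ 2
    + 2 * (a / t * - (mu * (t * b))) * G =
    a ^+ 2 / t ^+ 2 + t ^+ 2 * (mu ^+ 2 * b ^+ 2) - 2 * mu * (a * b * G).
    by field; rewrite gt_eqF.
  move=> h; rewrite mulrC -ler_pdivlMr ?exprn_gt0 //.
  have : t ^+ 2 * (mu ^+ 2 * b ^+ 2) <= mu ^+ 2 * b ^+ 2.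
    apply: ler_piMl; first by rewrite mulr_ge0 ?sqr_ge0.
    by rewrite exprn_ile1 // ltW.
  by move: h; lra.
move: key; set X := _ + _ - _ => key.
suff : X <= a ^+ 2 by rewrite /X; lra.
rewrite leNgt; apply/negP => aX.
have X0 : 0 < X by apply: le_lt_trans aX; exact: sqr_ge0.
have aX0 : 0 < a ^+ 2 / X by rewrite divr_gt0 ?exprn_gt0.
have aX1 : a ^+ 2 / X < 1 by rewrite ltr_pdivrMr // mul1r.
(* Otherwise some z in ]0, 1[ has z ^+ 2 strictly between a ^+ 2 / X and 1. *)
pose z := Num.sqrt ((a ^+ 2 / X + 1) / 2).
have z2 : z ^+ 2 = (a ^+ 2 / X + 1) / 2 by rewrite sqr_sqrtr //; lra.
have z0 : 0 < z by rewrite sqrtr_gt0; lra.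
have z1 : z < 1 by rewrite -(@expr_lt1 _ 2%N) // ?z2 ?ltW //; lra.
have := key z z0 z1; rewrite z2 -ler_pdivlMr //; lra.
Qed.

(** Writing [radial_sup Omega u = rho / cos (phi u)], the right-hand side
    divided by the product of the radii is [cos (phi u - phi v)]: the angle
    [phi] is 1-Lipschitz for the angular distance between directions.  For
    equal radii this is the Cauchy-Schwarz inequality.  For distinct radii it
    comes from [radial_dist] with [mu] the ratio of the two square roots, the
    value at which the bound of [radial_dist] is an equality when both boundary
    points lie on a common tangent line to the small ball, on the same side of
    the point of tangency. *)
Lemma radial_dot u v : enorm u = 1 -> enorm v = 1 ->
  radial_sup Omega u * radial_sup Omega v * dot u v <=
    rho ^+ 2 + Num.sqrt (radial_sup Omega u ^+ 2 - rho ^+ 2)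
             * Num.sqrt (radial_sup Omega v ^+ 2 - rho ^+ 2).
Proof.
wlog le_uv : u v / radial_sup Omega u <= radial_sup Omega v.
  move=> W u1 v1; have [/W|/ltW/W] := leP (radial_sup Omega u) (radial_sup Omega v).
    exact.
  move=> /(_ v1 u1); rewrite dotC [X in X * dot _ _]mulrC.
  by rewrite [X in _ + X]mulrC.
move=> u1 v1; have D mu := @radial_dist u v mu u1 v1.
move: D (dot_unit_le1 u1 v1) (radial_ge u1) le_uv.
move: (radial_sup Omega u) (radial_sup Omega v) (dot u v) => a b G D G1 ra ab.
have rho0 := rho_gt0; have rho_a : rho <= a := le_trans rho_le_r ra.
have ha : rho ^+ 2 <= a ^+ 2 by rewrite lerXn2r ?nnegrE //; lra.
have hb : rho ^+ 2 <= b ^+ 2 by rewrite lerXn2r ?nnegrE //; lra.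
set k := Num.sqrt (a ^+ 2 - rho ^+ 2); set l := Num.sqrt (b ^+ 2 - rho ^+ 2).
have k0 : 0 <= k by exact: sqrtr_ge0.
have l0 : 0 <= l by exact: sqrtr_ge0.
have k2 : a ^+ 2 = k ^+ 2 + rho ^+ 2 by rewrite sqr_sqrtr ?subr_ge0 // subrK.
have l2 : b ^+ 2 = l ^+ 2 + rho ^+ 2 by rewrite sqr_sqrtr ?subr_ge0 // subrK.
move: ab; rewrite le_eqVlt => /predU1P[e|ab].
  have -> : l = k by rewrite /l -e.
  rewrite -e -!expr2 addrC -k2 -[leRHS]mulr1 ler_wpM2l ?sqr_ge0 //.
have kl : k < l.
  have : a ^+ 2 < b ^+ 2 by rewrite ltr_pXn2r ?nnegrE //; lra.
  by rewrite k2 l2 ltrD2r ltr_pXn2r.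
have {}D mu : 0 <= mu < 1 ->
    2 * mu * (a * b * G - rho ^+ 2) <= mu ^+ 2 * l ^+ 2 + k ^+ 2.
  by move=> /D; rewrite k2 l2; lra.
move: D; set E := a * b * G => D.
rewrite -lerBlDl leNgt; apply/negP => lt.
(* For k > 0, D at mu = k / l is the claim.  For k = 0 this mu vanishes and D
   is trivial there, but the linear term in mu dominates near 0, so a small
   positive mu is used. *)
move: k0; rewrite le_eqVlt => /predU1P[k0|k0].
  rewrite -k0 mul0r in lt; rewrite -k0 in kl.
  pose mu := Num.min (1 / 2) ((E - rho ^+ 2) / l ^+ 2).
  have m0 : 0 < mu by rewrite lt_min; apply/andP; split; [lra|rewrite divr_gt0 ?exprn_gt0].
  have m1 : mu <= 1 / 2 by rewrite ge_min lexx.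
  have m2 : mu * l ^+ 2 <= E - rho ^+ 2.
    by rewrite -ler_pdivlMr ?exprn_gt0 // ge_min lexx orbT.
  have := D mu; rewrite -k0; move: m2 lt; set F := E - _ => m2 lt.
  move/(_ ltac:(apply/andP; split; lra)).
  have := ler_wpM2l (ltW m0) m2; have := mulr_gt0 m0 lt; lra.
have l1 : 0 < l by exact: lt_trans kl.
have kl01 : 0 <= k / l < 1.
  by rewrite divr_ge0 // ?ltr_pdivrMr ?mul1r // ltW.
have := D (k / l) kl01.
have -> : (k / l) ^+ 2 * l ^+ 2 + k ^+ 2 = 2 * k ^+ 2 by field; rewrite gt_eqF.
have := ltr_pM2l (divr_gt0 k0 l1) (k * l) (E - rho ^+ 2); rewrite lt.
have -> : k / l * (k * l) = k ^+ 2 by field; rewrite gt_eqF.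
lra.
Qed.
End Radial.

(** * Comparison of two dilations *)

Lemma sqr_homo (K : realFieldType) (x y : K) :
  0 <= x -> x <= y -> x ^+ 2 <= y ^+ 2.
Proof. by move=> x0 xy; rewrite lerXn2r // nnegrE (le_trans x0). Qed.

Lemma le_of_sqr (K : realFieldType) (x y : K) :
  0 <= y -> x ^+ 2 <= y ^+ 2 -> x <= y.
Proof.
move=> y0 h; rewrite leNgt; apply/negP => yx.
by move: h; rewrite leNgt ltrXn2r // ?nnegrE // (le_trans y0) // ltW.
Qed.

Lemma quad_form_ge (K : realFieldType) (P Q T g X Y : K) :
  0 <= P -> 0 <= Q -> 0 <= T -> 0 <= g -> 0 <= X -> 0 <= Y ->
  (T * g) ^+ 2 <= P * Q ->
  2 * (T * g) * (X * Y) <= P * X ^+ 2 + Q * Y ^+ 2.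
Proof.
move=> P0 Q0 T0 g0 X0 Y0 h.
have S0 : 0 <= P * X ^+ 2 + Q * Y ^+ 2.
  by rewrite addr_ge0 // mulr_ge0 // sqr_ge0.
apply: le_of_sqr => //.
have := ler_wpM2r (sqr_ge0 (X * Y)) h.
have := sqr_ge0 (P * X ^+ 2 - Q * Y ^+ 2).
lra.
Qed.

(** The determinant condition making the quadratic form
    [d ^+ 2 * |x - y| ^+ 2 - |a x - b y| ^+ 2] or its opposite nonnegative when
    the angle between [x] and [y] is the smallest one allowed.  Because
    [(rho ^+ 2 + k * l) ^+ 2 = (a * b) ^+ 2 - rho ^+ 2 * (k - l) ^+ 2], it is
    equivalent to
    [a * b * d * |a - b| <= rho * |d ^+ 2 - a * b| * |k - l|], and the identity
    [(a - b) * (a + b) = (k - l) * (k + l)] cancels the differences. *)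
Lemma det_distortion_ge (K : realFieldType) (rho a b k l d : K) :
  0 < rho -> 0 < a -> 0 < b -> 0 <= k -> 0 <= l -> 0 <= d ->
  a ^+ 2 = k ^+ 2 + rho ^+ 2 -> b ^+ 2 = l ^+ 2 + rho ^+ 2 ->
  a * b * d * (k + l) <= rho * `|d ^+ 2 - a * b| * (a + b) ->
  ((d ^+ 2 - a * b) * ((rho ^+ 2 + k * l) / (a * b))) ^+ 2 <=
    (d ^+ 2 - a ^+ 2) * (d ^+ 2 - b ^+ 2).
Proof.
move=> r0 a0 b0 k0 l0 d0 ak bl h.
set T := d ^+ 2 - a * b; set s := a * b.
have s0 : 0 < s by rewrite mulr_gt0.
have hg : (rho ^+ 2 + k * l) ^+ 2 = s ^+ 2 - rho ^+ 2 * (k - l) ^+ 2.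
  rewrite /s exprMn ak bl; ring.
have e : (d ^+ 2 - a ^+ 2) * (d ^+ 2 - b ^+ 2) = T ^+ 2 - d ^+ 2 * (a - b) ^+ 2.
  rewrite /T; ring.
rewrite e !exprMn hg exprVn.
have s2 : 0 < s ^+ 2 by rewrite exprn_gt0.
rewrite mulrA ler_pdivrMr //.
have {}h : (s * d * (k + l)) ^+ 2 <= rho ^+ 2 * T ^+ 2 * (a + b) ^+ 2.
  rewrite -[T ^+ 2]real_normK ?num_real // -!exprMn.
  by rewrite lerXn2r // nnegrE; rewrite !mulr_ge0 ?addr_ge0 // ltW.
have hab : (a - b) * (a + b) = (k - l) * (k + l).
  by have -> : (a - b) * (a + b) = a ^+ 2 - b ^+ 2; [ring | rewrite ak bl; ring].
have ab0 : 0 < (a + b) ^+ 2 by rewrite exprn_gt0 ?addr_gt0.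
have : s ^+ 2 * d ^+ 2 * (a - b) ^+ 2 <= rho ^+ 2 * T ^+ 2 * (k - l) ^+ 2.
  rewrite -(ler_pM2r ab0).
  have -> : s ^+ 2 * d ^+ 2 * (a - b) ^+ 2 * (a + b) ^+ 2 =
    (k - l) ^+ 2 * (s * d * (k + l)) ^+ 2.
    have -> : s ^+ 2 * d ^+ 2 * (a - b) ^+ 2 * (a + b) ^+ 2 =
      s ^+ 2 * d ^+ 2 * ((a - b) * (a + b)) ^+ 2 by ring.
    rewrite hab; ring.
  have := ler_wpM2l (sqr_ge0 (k - l)) h; lra.
lra.
Qed.

(** This makes the lower bound work with a single value of [lower_fun], the one
    at the geometric mean [x] of the two radii: the mean slope
    [a * b * (k + l) / (a + b)] is at most [x * sqrt (x ^+ 2 - rho ^+ 2)].  The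
    estimate rests on
    [rho ^+ 2 * (a - b) ^+ 2 = (a * b - rho ^+ 2) ^+ 2 - (k * l) ^+ 2]. *)
Lemma geom_mean_slope (K : rcfType) (rho a b k l : K) :
  0 < rho -> 0 < a -> 0 < b -> 0 <= k -> 0 <= l ->
  a ^+ 2 = k ^+ 2 + rho ^+ 2 -> b ^+ 2 = l ^+ 2 + rho ^+ 2 ->
  a * b * (k + l) <= Num.sqrt (a * b) * Num.sqrt (a * b - rho ^+ 2) * (a + b).
Proof.
move=> r0 a0 b0 k0 l0 ak bl.
have s0 : 0 < a * b by rewrite mulr_gt0.
have kl : k * l + rho ^+ 2 <= a * b.
  apply: le_of_sqr; [exact: ltW | rewrite exprMn ak bl].
  have := sqr_ge0 (rho * (k - l)); lra.
have kl0 : 0 <= k * l by rewrite mulr_ge0.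
have r2 : 0 < rho ^+ 2 by rewrite exprn_gt0.
set s := a * b in s0 kl *.
set p := s - rho ^+ 2.
have p0 : 0 <= p by rewrite /p; lra.
apply: le_of_sqr; first by rewrite !mulr_ge0 ?sqrtr_ge0 ?addr_ge0 // ltW.
have -> : (s * (k + l)) ^+ 2 = s * (s * (k + l) ^+ 2) by ring.
rewrite 2!exprMn !sqr_sqrtr ?(ltW s0) // -mulrA ler_wpM2l ?(ltW s0) //.
have e1 : (k + l) ^+ 2 = (a + b) ^+ 2 - 2 * (p - k * l) - 4 * rho ^+ 2.
  have : (a + b) ^+ 2 = a ^+ 2 + b ^+ 2 + 2 * s by rewrite /s; ring.
  rewrite ak bl /p => ->; ring.
have e2 : rho ^+ 2 * ((a + b) ^+ 2 - 4 * s) = (p - k * l) * (p + k * l).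
  have -> : (a + b) ^+ 2 - 4 * s = a ^+ 2 + b ^+ 2 - 2 * s by rewrite /s; ring.
  have -> : (p - k * l) * (p + k * l) = p ^+ 2 - k ^+ 2 * l ^+ 2 by ring.
  have -> : k ^+ 2 = a ^+ 2 - rho ^+ 2 by lra.
  have -> : l ^+ 2 = b ^+ 2 - rho ^+ 2 by lra.
  rewrite /p /s; ring.
rewrite e1.
have h : (p - k * l) * (p + k * l) <= (p - k * l) * (2 * s).
  by apply: ler_wpM2l; rewrite /p; lra.
rewrite -e2 in h.
have -> : s = p + rho ^+ 2 by rewrite /p subrK.
move: h; have -> : s = p + rho ^+ 2 by rewrite /p subrK.
lra.
Qed.

(** The scalar content of both estimates: [X], [Y] are the norms of two vectors,
    [G] the cosine of their angle, [a], [b] their dilation factors and [d] the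
    candidate Lipschitz constant.  In both parts the cross term has the sign
    that makes the largest value of [G] the worst case, and for that value the
    quadratic form is nonnegative by its determinant. *)
Lemma distortion_pair (K : realFieldType) (rho a b k l d G X Y : K) :
  0 < rho -> 0 < a -> 0 < b -> 0 <= k -> 0 <= l -> 0 <= d ->
  0 <= X -> 0 <= Y ->
  a ^+ 2 = k ^+ 2 + rho ^+ 2 -> b ^+ 2 = l ^+ 2 + rho ^+ 2 ->
  a * b * G <= rho ^+ 2 + k * l ->
  a * b * d * (k + l) <= rho * `|d ^+ 2 - a * b| * (a + b) ->
  (0 <= d ^+ 2 - a ^+ 2 -> 0 <= d ^+ 2 - b ^+ 2 -> 0 <= d ^+ 2 - a * b ->
   a ^+ 2 * X ^+ 2 + b ^+ 2 * Y ^+ 2 - 2 * (a * b) * (X * Y) * G <=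
     d ^+ 2 * (X ^+ 2 + Y ^+ 2 - 2 * (X * Y) * G)) /\
  (0 <= a ^+ 2 - d ^+ 2 -> 0 <= b ^+ 2 - d ^+ 2 -> 0 <= a * b - d ^+ 2 ->
   d ^+ 2 * (X ^+ 2 + Y ^+ 2 - 2 * (X * Y) * G) <=
     a ^+ 2 * X ^+ 2 + b ^+ 2 * Y ^+ 2 - 2 * (a * b) * (X * Y) * G).
Proof.
move=> r0 a0 b0 k0 l0 d0 X0 Y0 ak bl hG h.
have ab0 : 0 < a * b by rewrite mulr_gt0.
have := det_distortion_ge r0 a0 b0 k0 l0 d0 ak bl h.
set g := (rho ^+ 2 + k * l) / (a * b) => det.
have Gg : G <= g by rewrite ler_pdivlMr // mulrC.
have g0 : 0 <= g by rewrite divr_ge0 ?addr_ge0 ?mulr_ge0 ?sqr_ge0 // ltW.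
have XY0 : 0 <= X * Y by rewrite mulr_ge0.
split=> P0 Q0 T0.
  have := quad_form_ge P0 Q0 T0 g0 X0 Y0 det.
  have := ler_wpM2l (mulr_ge0 T0 XY0) Gg; lra.
have det' : ((a * b - d ^+ 2) * g) ^+ 2 <=
    (a ^+ 2 - d ^+ 2) * (b ^+ 2 - d ^+ 2).
  have -> : ((a * b - d ^+ 2) * g) ^+ 2 = ((d ^+ 2 - a * b) * g) ^+ 2 by ring.
  by apply: le_trans det _; lra.
have := quad_form_ge P0 Q0 T0 g0 X0 Y0 det'.
have := ler_wpM2l (mulr_ge0 T0 XY0) Gg; lra.
Qed.

(** * The constants *)

Lemma sqrtrB_sqr (K : rcfType) (rho a : K) : 0 < rho -> rho <= a ->
  a ^+ 2 = Num.sqrt (a ^+ 2 - rho ^+ 2) ^+ 2 + rho ^+ 2.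
Proof.
by move=> r0 ra; rewrite sqr_sqrtr ?subrK // subr_ge0 sqr_homo // ltW.
Qed.

Lemma sqrtrD_sqr (K : rcfType) (rho a : K) :
  Num.sqrt (a ^+ 2 + 3 * rho ^+ 2) ^+ 2 = a ^+ 2 + 3 * rho ^+ 2.
Proof.
rewrite sqr_sqrtr //; have := sqr_ge0 a; have := sqr_ge0 rho; lra.
Qed.

Section Constants.
Variables (K : realType) (rho : K).
Hypothesis rho_gt0 : 0 < rho.
Implicit Types a b c : K.

Lemma upper_const_ge0 R : rho <= R -> 0 <= upper_const rho R.
Proof.
move=> rR; have r0 := rho_gt0.
by rewrite /upper_const mulr_ge0 ?addr_ge0 ?sqrtr_ge0 ?divr_ge0 //; lra.
Qed.

(** The constant [upper_const rho R] is the larger singular value of [R] times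
    the shear with entry [m = sqrt (R ^+ 2 - rho ^+ 2) / rho], which is how the
    expansion acts to first order in polar coordinates at a point of radius [R]
    where the boundary is as steep as possible. *)
Lemma upper_const_root R : rho <= R ->
  rho * upper_const rho R ^+ 2 =
    rho * R ^+ 2 + R * Num.sqrt (R ^+ 2 - rho ^+ 2) * upper_const rho R.
Proof.
move=> rR; have := sqrtrB_sqr rho_gt0 rR; have := sqrtrD_sqr rho R.
rewrite /upper_const; set p := Num.sqrt _; set q := Num.sqrt _ => p2 q2.
have e : (p - q) * (p + q) = 4 * rho ^+ 2.
  have -> : (p - q) * (p + q) = p ^+ 2 - q ^+ 2 by ring.
  lra.
have -> : rho * (R / (2 * rho) * (p + q)) ^+ 2 =
   R ^+ 2 / (4 * rho) * ((p - q) * (p + q)) + R * q * (R / (2 * rho) * (p + q)).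
  by field; rewrite gt_eqF.
by rewrite e; congr (_ + _); field; rewrite gt_eqF.
Qed.

Lemma upper_const_ge R : rho <= R -> R <= upper_const rho R.
Proof.
move=> rR; have r0 := rho_gt0; have C0 := upper_const_ge0 rR.
apply: le_of_sqr => //.
have := upper_const_root rR.
have : 0 <= R * Num.sqrt (R ^+ 2 - rho ^+ 2) * upper_const rho R.
  by apply: (mulr_ge0 _ C0); apply: (mulr_ge0 _ (sqrtr_ge0 _)); lra.
move=> h e; rewrite -(ler_pM2l r0); lra.
Qed.

Lemma sqrt_gap_ge0 a : rho <= a ->
  0 <= Num.sqrt (a ^+ 2 + 3 * rho ^+ 2) - Num.sqrt (a ^+ 2 - rho ^+ 2).
Proof.
move=> ra; rewrite subr_ge0; apply: ler_wsqrtr.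
have := sqr_ge0 rho; lra.
Qed.

(** The gap equals [4 * rho ^+ 2] divided by the sum of the two roots, and that
    sum increases with [a]. *)
Lemma sqrt_gap_anti a b : rho <= a -> a <= b ->
  Num.sqrt (b ^+ 2 + 3 * rho ^+ 2) - Num.sqrt (b ^+ 2 - rho ^+ 2) <=
  Num.sqrt (a ^+ 2 + 3 * rho ^+ 2) - Num.sqrt (a ^+ 2 - rho ^+ 2).
Proof.
move=> ra ab; have rb := le_trans ra ab; have r0 := rho_gt0.
have ab2 : a ^+ 2 <= b ^+ 2 by apply: sqr_homo => //; exact: le_trans (ltW r0) ra.
have := sqrtrB_sqr rho_gt0 ra; have := sqrtrD_sqr rho a.
have := sqrtrB_sqr rho_gt0 rb; have := sqrtrD_sqr rho b.
have : Num.sqrt (a ^+ 2 + 3 * rho ^+ 2) <= Num.sqrt (b ^+ 2 + 3 * rho ^+ 2).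
  by apply: ler_wsqrtr; lra.
have : Num.sqrt (a ^+ 2 - rho ^+ 2) <= Num.sqrt (b ^+ 2 - rho ^+ 2).
  by apply: ler_wsqrtr; lra.
have : 0 < Num.sqrt (a ^+ 2 + 3 * rho ^+ 2).
  rewrite sqrtr_gt0; have := exprn_gt0 2 r0; have := sqr_ge0 a; lra.
have := sqrtr_ge0 (a ^+ 2 - rho ^+ 2).
have := sqrt_gap_ge0 rb.
set P := Num.sqrt (b ^+ 2 + 3 * rho ^+ 2).
set Q := Num.sqrt (b ^+ 2 - rho ^+ 2).
set p := Num.sqrt (a ^+ 2 + 3 * rho ^+ 2).
set q := Num.sqrt (a ^+ 2 - rho ^+ 2).
move=> e0 q0 p0 qQ pP P2 Q2 p2 q2.
have pq : 0 < p + q by lra.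
have h : (P - Q) * (p + q) <= (P - Q) * (P + Q) by apply: ler_wpM2l => //; lra.
rewrite -(ler_pM2r pq); apply: le_trans h _.
have -> : (P - Q) * (P + Q) = P ^+ 2 - Q ^+ 2 by ring.
have -> : (p - q) * (p + q) = p ^+ 2 - q ^+ 2 by ring.
lra.
Qed.

Lemma lower_fun_ge0 a : rho <= a -> 0 <= lower_fun rho a.
Proof.
move=> ra; have r0 := rho_gt0.
by rewrite /lower_fun mulr_ge0 ?sqrt_gap_ge0 ?divr_ge0 //; lra.
Qed.

(** The quadratic equation of [upper_const_root] with the sign of the shear
    reversed: [lower_fun rho a] is the smaller singular value. *)
Lemma lower_fun_root a : rho <= a ->
  rho * lower_fun rho a ^+ 2
    + a * Num.sqrt (a ^+ 2 - rho ^+ 2) * lower_fun rho a = rho * a ^+ 2.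
Proof.
move=> ra; have := sqrtrB_sqr rho_gt0 ra; have := sqrtrD_sqr rho a.
rewrite /lower_fun; set p := Num.sqrt _; set q := Num.sqrt _ => p2 q2.
have e : (p - q) * (p + q) = 4 * rho ^+ 2.
  have -> : (p - q) * (p + q) = p ^+ 2 - q ^+ 2 by ring.
  lra.
have -> : rho * (a / (2 * rho) * (p - q)) ^+ 2 + a * q * (a / (2 * rho) * (p - q))
   = a ^+ 2 / (4 * rho) * ((p - q) * (p + q)).
  by field; rewrite gt_eqF.
by rewrite e; field; rewrite gt_eqF.
Qed.

Lemma le_lower_fun a c : rho <= a -> 0 <= c -> c <= lower_fun rho a ->
  rho * c ^+ 2 + a * Num.sqrt (a ^+ 2 - rho ^+ 2) * c <= rho * a ^+ 2.
Proof.
move=> ra c0 cf; rewrite -(lower_fun_root ra); have r0 := rho_gt0.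
apply: lerD; rewrite ler_wpM2l //.
- exact: ltW.
- exact: sqr_homo.
- by rewrite mulr_ge0 ?sqrtr_ge0 //; lra.
Qed.

Lemma lower_fun_le_id a : rho <= a -> lower_fun rho a <= a.
Proof.
move=> ra; have r0 := rho_gt0; have f0 := lower_fun_ge0 ra.
have a0 : 0 <= a by lra.
apply: le_of_sqr => //; rewrite -(ler_pM2l r0) -(lower_fun_root ra) lerDl.
exact: mulr_ge0 (mulr_ge0 a0 (sqrtr_ge0 _)) f0.
Qed.

(** In terms of the squared gap [w] between the two roots, the square of
    [lower_fun] is a quadratic polynomial with vertex at [w = 2 * rho ^+ 2].
    As [w] is monotone in [a], this replaces any study of the derivative. *)
Lemma lower_fun_sqr a : rho <= a ->
  lower_fun rho a ^+ 2 =
    (((Num.sqrt (a ^+ 2 + 3 * rho ^+ 2) - Num.sqrt (a ^+ 2 - rho ^+ 2)) ^+ 2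
       - 2 * rho ^+ 2) ^+ 2 + 12 * rho ^+ 4) / (16 * rho ^+ 2).
Proof.
move=> ra; have := sqrtrB_sqr rho_gt0 ra; have := sqrtrD_sqr rho a.
rewrite /lower_fun; set p := Num.sqrt _; set q := Num.sqrt _ => p2 q2.
have rn : rho != 0 by rewrite gt_eqF.
have r2 : rho ^+ 2 = (p ^+ 2 - q ^+ 2) / 4 by lra.
have a2 : a ^+ 2 = (p ^+ 2 + 3 * q ^+ 2) / 4 by lra.
have -> : (a / (2 * rho) * (p - q)) ^+ 2 =
   4 * a ^+ 2 * (p - q) ^+ 2 / (16 * rho ^+ 2) by field.
congr (_ / _); have -> : rho ^+ 4 = rho ^+ 2 * rho ^+ 2 by ring.
by rewrite r2 a2; field.
Qed.

Definition lower_argmin : K := Num.sqrt (3 / 2) * rho.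

Lemma lower_argmin_ge : rho <= lower_argmin.
Proof.
apply: ler_peMl; first exact: ltW.
by rewrite -[leLHS]sqrtr1; apply: ler_wsqrtr; lra.
Qed.

Lemma sqrt_gap_argmin :
  (Num.sqrt (lower_argmin ^+ 2 + 3 * rho ^+ 2)
    - Num.sqrt (lower_argmin ^+ 2 - rho ^+ 2)) ^+ 2 = 2 * rho ^+ 2.
Proof.
have a2 : lower_argmin ^+ 2 = 3 / 2 * rho ^+ 2.
  by rewrite /lower_argmin exprMn sqr_sqrtr //; lra.
have r0 := rho_gt0.
have -> : lower_argmin ^+ 2 + 3 * rho ^+ 2 = (1 / 2) * (3 * rho) ^+ 2.
  by rewrite a2; field.
have -> : lower_argmin ^+ 2 - rho ^+ 2 = (1 / 2) * rho ^+ 2 by rewrite a2; field.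
have h : (0 : K) <= 1 / 2 by lra.
have sq z : 0 <= z -> Num.sqrt (1 / 2 * z ^+ 2) = Num.sqrt (1 / 2) * z.
  by move=> z0; rewrite sqrtrM // sqrtr_sqr ger0_norm.
rewrite !sq; try lra.
have -> : (Num.sqrt (1 / 2 : K) * (3 * rho) - Num.sqrt (1 / 2) * rho) ^+ 2 =
  4 * (Num.sqrt (1 / 2)) ^+ 2 * rho ^+ 2 by ring.
by rewrite sqr_sqrtr //; field.
Qed.

Lemma lower_fun_argmin : lower_fun rho lower_argmin = Num.sqrt 3 / 2 * rho.
Proof.
have r0 := rho_gt0; have f0 := lower_fun_ge0 lower_argmin_ge.
apply: (@pexpIrn _ 2%N) => //; rewrite ?nnegrE //.
  by rewrite mulr_ge0 ?divr_ge0 ?sqrtr_ge0 // ltW.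
rewrite lower_fun_sqr ?lower_argmin_ge // sqrt_gap_argmin.
have -> : (Num.sqrt 3 / 2 * rho) ^+ 2 = Num.sqrt 3 ^+ 2 / 4 * rho ^+ 2 by field.
by rewrite sqr_sqrtr //; field; rewrite gt_eqF.
Qed.

(** By [lower_fun_sqr], values of [lower_fun] are ordered as the distances of
    the squared gaps from the vertex. *)
Lemma lower_fun_le a b : rho <= a -> rho <= b ->
  `|(Num.sqrt (a ^+ 2 + 3 * rho ^+ 2) - Num.sqrt (a ^+ 2 - rho ^+ 2)) ^+ 2
     - 2 * rho ^+ 2| <=
  `|(Num.sqrt (b ^+ 2 + 3 * rho ^+ 2) - Num.sqrt (b ^+ 2 - rho ^+ 2)) ^+ 2
     - 2 * rho ^+ 2| ->
  lower_fun rho a <= lower_fun rho b.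
Proof.
move=> ra rb h; apply: le_of_sqr; first exact: lower_fun_ge0.
rewrite !lower_fun_sqr // ler_pM2r ?invr_gt0 ?mulr_gt0 ?exprn_gt0 //.
rewrite lerD2r -real_normK ?num_real // -[leRHS]real_normK ?num_real //.
exact: sqr_homo.
Qed.

Lemma lower_fun_homo a b : rho <= a -> lower_argmin <= a -> a <= b ->
  lower_fun rho a <= lower_fun rho b.
Proof.
move=> ra ma ab; have rb := le_trans ra ab; apply: lower_fun_le => //.
have h1 := sqrt_gap_anti ra ab.
have h2 := sqrt_gap_anti lower_argmin_ge ma.
have h3 := sqrt_gap_ge0 rb; have h4 := sqrt_gap_ge0 ra.
have h5 := sqrt_gap_ge0 lower_argmin_ge.
have s1 := sqr_homo h3 h1; have s2 := sqr_homo h4 h2.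
rewrite sqrt_gap_argmin in s2.
rewrite !ler0_norm; lra.
Qed.

Lemma lower_fun_nhomo a b : rho <= a -> a <= b -> b <= lower_argmin ->
  lower_fun rho b <= lower_fun rho a.
Proof.
move=> ra ab bm; have rb := le_trans ra ab; apply: lower_fun_le => //.
have h1 := sqrt_gap_anti ra ab.
have h2 := sqrt_gap_anti rb bm.
have h3 := sqrt_gap_ge0 rb; have h4 := sqrt_gap_ge0 ra.
have h5 := sqrt_gap_ge0 lower_argmin_ge.
have s1 := sqr_homo h3 h1; have s2 := sqr_homo h5 h2.
rewrite sqrt_gap_argmin in s2.
rewrite !ger0_norm; lra.
Qed.

Lemma lower_const_eq r R a0 : r <= a0 <= R ->
  (forall a, r <= a <= R -> lower_fun rho a0 <= lower_fun rho a) ->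
  lower_const rho r R = lower_fun rho a0.
Proof.
move=> a0in h; apply/eqP; rewrite eq_le; apply/andP; split.
  apply: ge_inf; last by exists a0 => //=; rewrite in_itv.
  by exists (lower_fun rho a0) => _ /= [a + <-]; rewrite in_itv /= => /h.
apply: lb_le_inf; first by exists (lower_fun rho a0), a0 => //=; rewrite in_itv.
by move=> _ /= [a + <-]; rewrite in_itv /= => /h.
Qed.

Lemma lower_const_right r R : rho <= r -> r <= R -> lower_argmin <= r ->
  lower_const rho r R = lower_fun rho r.
Proof.
move=> rr rR mr; apply: lower_const_eq; first by rewrite lexx.
by move=> a /andP[ra aR]; exact: lower_fun_homo.
Qed.

Lemma lower_const_mid r R : rho <= r -> r <= lower_argmin <= R ->
  lower_const rho r R = lower_fun rho lower_argmin.
Proof.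
move=> rr mr; apply: lower_const_eq => // a /andP[ra aR].
have rra := le_trans rr ra.
apply: lower_fun_le => //; first exact: lower_argmin_ge.
by rewrite sqrt_gap_argmin subrr normr0.
Qed.

Lemma lower_const_left r R : rho <= r -> r <= R -> R <= lower_argmin ->
  lower_const rho r R = lower_fun rho R.
Proof.
move=> rr rR mr; apply: lower_const_eq; first by rewrite lexx andbT.
by move=> a /andP[ra aR]; apply: lower_fun_nhomo => //; exact: le_trans ra.
Qed.

Lemma lower_const_attained r R : rho <= r -> r <= R ->
  [set lower_fun rho a | a in `[r, R]] (lower_const rho r R).
Proof.
move=> rr rR; have [mr|/ltW rm] := leP lower_argmin r.
  by exists r; rewrite ?lower_const_right //= in_itv /= lexx.
have [mR|/ltW Rm] := leP lower_argmin R.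
  by exists lower_argmin; rewrite ?lower_const_mid //= ?in_itv /= rm.
by exists R; rewrite ?lower_const_left //= in_itv /= lexx rR.
Qed.

Lemma lower_const_le r R a : rho <= r -> r <= a <= R ->
  lower_const rho r R <= lower_fun rho a.
Proof.
move=> rr ain; apply: ge_inf; last by exists a => //=; rewrite in_itv.
exists 0 => _ /= [b + <-]; rewrite in_itv /= => /andP[rb _].
by apply: lower_fun_ge0; exact: le_trans rb.
Qed.

Lemma lower_const_le_id r R a : rho <= r -> r <= a <= R ->
  lower_const rho r R <= a.
Proof.
move=> rr ain; have /andP[ra _] := ain; have rhoa := le_trans rr ra.
exact: le_trans (lower_const_le rr ain) (lower_fun_le_id rhoa).
Qed.

Lemma lower_const_ge0 r R : rho <= r -> r <= R -> 0 <= lower_const rho r R.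
Proof.
move=> rr rR; have [a + <-] := lower_const_attained rr rR.
rewrite /= in_itv /= => /andP[ra _].
by apply: lower_fun_ge0; exact: le_trans ra.
Qed.
End Constants.

(** * Bi-Lipschitz bounds *)

(** It is enough to compare slopes: the constant [C] for the outer radius solves
    [rho * C ^+ 2 = rho * R ^+ 2 + R * M * C] with
    [M = sqrt (R ^+ 2 - rho ^+ 2)], while [a * b <= R ^+ 2] and both
    [a * k] and [b * l] are at most [R * M]. *)
Lemma upper_pair (K : realType) (rho R a b G X Y : K) :
  0 < rho -> rho <= a <= R -> rho <= b <= R -> 0 <= X -> 0 <= Y ->
  a * b * G <= rho ^+ 2 +
    Num.sqrt (a ^+ 2 - rho ^+ 2) * Num.sqrt (b ^+ 2 - rho ^+ 2) ->
  a ^+ 2 * X ^+ 2 + b ^+ 2 * Y ^+ 2 - 2 * (a * b) * (X * Y) * G <=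
    upper_const rho R ^+ 2 * (X ^+ 2 + Y ^+ 2 - 2 * (X * Y) * G).
Proof.
move=> r0 /andP[ra aR] /andP[rb bR] X0 Y0 hG.
have rR := le_trans ra aR.
have a0 := lt_le_trans r0 ra; have b0 := lt_le_trans r0 rb.
have R0 := lt_le_trans r0 rR.
have CR := upper_const_ge r0 rR; have root := upper_const_root r0 rR.
have C0 := upper_const_ge0 r0 rR.
move: CR root C0; set C := upper_const rho R; set M := Num.sqrt (R ^+ 2 - _).
move=> CR root C0.
have M0 : 0 <= M by exact: sqrtr_ge0.
have slope z : 0 < z -> z <= R -> Num.sqrt (z ^+ 2 - rho ^+ 2) <= M.
  by move=> z0 zR; apply: ler_wsqrtr; rewrite lerD2r sqr_homo // ltW.
have kM := slope a a0 aR; have lM := slope b b0 bR.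
have ak := sqrtrB_sqr r0 ra; have bl := sqrtrB_sqr r0 rb.
have k0 := sqrtr_ge0 (a ^+ 2 - rho ^+ 2).
have l0 := sqrtr_ge0 (b ^+ 2 - rho ^+ 2).
move: hG kM lM ak bl k0 l0.
set k := Num.sqrt (a ^+ 2 - _); set l := Num.sqrt (b ^+ 2 - _).
move=> hG kM lM ak bl k0 l0.
have aC2 : a ^+ 2 <= C ^+ 2 by apply: sqr_homo; [exact: ltW | exact: le_trans CR].
have bC2 : b ^+ 2 <= C ^+ 2 by apply: sqr_homo; [exact: ltW | exact: le_trans CR].
have abR : a * b <= R ^+ 2 by rewrite expr2 ler_pM // ltW.
have RC : R ^+ 2 <= C ^+ 2 by apply: sqr_homo => //; exact: ltW.
have h : a * b * C * (k + l) <= rho * `|C ^+ 2 - a * b| * (a + b).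
  rewrite ger0_norm; last by lra.
  have e : R * M * C <= rho * (C ^+ 2 - a * b).
    have := ler_wpM2l (ltW r0) abR; lra.
  have ab0 : 0 <= a + b by rewrite addr_ge0 // ltW.
  apply: le_trans (ler_wpM2r ab0 e).
  have ha : a * k <= R * M by rewrite ler_pM // ltW.
  have hb : b * l <= R * M by rewrite ler_pM // ltW.
  have := ler_wpM2l (mulr_ge0 C0 (ltW b0)) ha.
  have := ler_wpM2l (mulr_ge0 C0 (ltW a0)) hb.
  lra.
have [up _] := distortion_pair r0 a0 b0 k0 l0 C0 X0 Y0 ak bl hG h.
by apply: up; lra.
Qed.

(** The geometric mean [x] of the two radii lies between [r] and [R], so the
    lower constant is at most [lower_fun rho x]; its quadratic equation and
    [geom_mean_slope] give the determinant condition. *)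
Lemma lower_pair (K : realType) (rho r R a b G X Y : K) :
  0 < rho -> rho <= r -> r <= a <= R -> r <= b <= R -> 0 <= X -> 0 <= Y ->
  a * b * G <= rho ^+ 2 +
    Num.sqrt (a ^+ 2 - rho ^+ 2) * Num.sqrt (b ^+ 2 - rho ^+ 2) ->
  lower_const rho r R ^+ 2 * (X ^+ 2 + Y ^+ 2 - 2 * (X * Y) * G) <=
    a ^+ 2 * X ^+ 2 + b ^+ 2 * Y ^+ 2 - 2 * (a * b) * (X * Y) * G.
Proof.
move=> rho0 rr aI bI X0 Y0 hG.
have /andP[ra aR] := aI; have /andP[rb bR] := bI.
have r0 := lt_le_trans rho0 rr.
have a0 := lt_le_trans r0 ra; have b0 := lt_le_trans r0 rb.
have R0 := lt_le_trans a0 aR.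
have rhoa := le_trans rr ra; have rhob := le_trans rr rb.
have c0 := lower_const_ge0 rho0 rr (le_trans ra aR).
have ab0 : 0 < a * b by rewrite mulr_gt0.
pose x := Num.sqrt (a * b).
have x2 : x ^+ 2 = a * b by rewrite sqr_sqrtr // ltW.
have x0 : 0 <= x by exact: sqrtr_ge0.
have rx : r <= x.
  by apply: le_of_sqr => //; rewrite x2 expr2 ler_pM // ltW.
have xR : x <= R.
  by apply: le_of_sqr; [exact: ltW | rewrite x2 expr2 ler_pM // ltW].
have xI : r <= x <= R by rewrite rx xR.
have sq (z : K) : r <= z <= R -> lower_const rho r R ^+ 2 <= z ^+ 2.
  by move=> zI; apply: sqr_homo => //; exact: lower_const_le_id.
have := le_lower_fun rho0 (le_trans rr rx) c0 (lower_const_le rho0 rr xI).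
rewrite x2; have := sq _ xI; rewrite x2; have := sq _ aI; have := sq _ bI.
move: c0; set c := lower_const rho r R => c0 cb ca cab root.
have ak := sqrtrB_sqr rho0 rhoa; have bl := sqrtrB_sqr rho0 rhob.
have k0 := sqrtr_ge0 (a ^+ 2 - rho ^+ 2).
have l0 := sqrtr_ge0 (b ^+ 2 - rho ^+ 2).
have slope := geom_mean_slope rho0 a0 b0 k0 l0 ak bl.
have h := ler_wpM2l c0 slope.
have {}root : x * Num.sqrt (a * b - rho ^+ 2) * c <= rho * (a * b - c ^+ 2).
  by lra.
have s0 : 0 <= a + b by rewrite addr_ge0 // ltW.
have {}root := ler_wpM2r s0 root.
have [|_ low] := distortion_pair rho0 a0 b0 k0 l0 c0 X0 Y0 ak bl hG.
  rewrite ler0_norm; last by lra.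
  by move: h root; rewrite -/x; lra.
by apply: low; lra.
Qed.

(** The origin is treated apart, since it has no direction: there the expansion
    is a dilation with a factor between [r] and [R]. *)
Lemma expansion_bounds (K : realType) (n : nat) (rho r R : K)
    (Omega : set 'rV[K]_n) (x y : 'rV[K]_n) :
  0 < rho -> rho <= r -> r <= R ->
  Omega `<=` eball R -> eball r `<=` Omega ->
  star_shaped Omega (eball rho) ->
  lower_const rho r R * enorm (x - y)
    <= enorm (expansion Omega x - expansion Omega y)
  /\ enorm (expansion Omega x - expansion Omega y)
    <= upper_const rho R * enorm (x - y).
Proof.
move=> rho0 rr rR subR subr star.
have rhoR := le_trans rr rR.
have c0 := lower_const_ge0 rho0 rr rR.
have C0 := upper_const_ge0 rho0 rhoR.
have sI (u : 'rV[K]_n) : enorm u = 1 -> r <= radial_sup Omega u <= R.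
  move=> u1; apply/andP; split; first exact: (radial_ge rho0 rr subR subr).
  exact: (radial_le rho0 rr subR subr).
pose u (z : 'rV[K]_n) := (enorm z)^-1 *: z.
have u1 z : z != 0 -> enorm (u z) = 1 by exact: enorm_normalize.
have uK z : z != 0 -> z = enorm z *: u z.
  by move=> /enorm_gt0 z0; rewrite scalerA mulfV ?scale1r // gt_eqF.
have Sx z : z != 0 -> expansion Omega z = radial_sup Omega (u z) *: z.
  by rewrite /expansion => /negPf ->.
have S0 : expansion Omega (0 : 'rV[K]_n) = 0 by rewrite /expansion eqxx.
have zero z : lower_const rho r R * enorm z <= enorm (expansion Omega z)
    /\ enorm (expansion Omega z) <= upper_const rho R * enorm z.
  have [->|z0] := eqVneq z 0; first by rewrite S0 enorm0 !mulr0.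
  have /andP[rs sR] := sI _ (u1 _ z0).
  have s0 : 0 <= radial_sup Omega (u z) by apply: le_trans rs; lra.
  rewrite Sx // enormZ //; split; rewrite ler_wpM2r ?enorm_ge0 //.
    by apply: lower_const_le_id => //; exact: sI (u1 _ z0).
  exact: le_trans sR (upper_const_ge rho0 rhoR).
have [->|x0] := eqVneq x 0.
  by rewrite S0 !sub0r !enormN; exact: zero.
have [->|y0] := eqVneq y 0.
  by rewrite S0 !subr0; exact: zero.
have ux := u1 _ x0; have uy := u1 _ y0.
have dotle := radial_dot rho0 rr subR subr star ux uy.
have aI := sI _ ux; have bI := sI _ uy.
have exy : enorm (x - y) ^+ 2 = enorm x ^+ 2 + enorm y ^+ 2
    - 2 * (enorm x * enorm y) * dot (u x) (u y).
  rewrite {1}(uK _ x0) {1}(uK _ y0) -scaleNr enorm_comb ux uy; ring.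
have eS : enorm (expansion Omega x - expansion Omega y) ^+ 2 =
    radial_sup Omega (u x) ^+ 2 * enorm x ^+ 2
    + radial_sup Omega (u y) ^+ 2 * enorm y ^+ 2
    - 2 * (radial_sup Omega (u x) * radial_sup Omega (u y))
        * (enorm x * enorm y) * dot (u x) (u y).
  have Su z : z != 0 ->
      expansion Omega z = (radial_sup Omega (u z) * enorm z) *: u z.
    by move=> z0; rewrite Sx // -scalerA -uK.
  by rewrite !Su // -scaleNr enorm_comb ux uy; ring.
have widen a : r <= a <= R -> rho <= a <= R.
  by move=> /andP[ra ->]; rewrite (le_trans rr).
split; apply: le_of_sqr.
- exact: enorm_ge0.
- rewrite exprMn exy eS.
  exact: lower_pair (enorm_ge0 x) (enorm_ge0 y) dotle.
- exact: mulr_ge0 C0 (enorm_ge0 _).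
- rewrite exprMn exy eS.
  by apply: upper_pair (enorm_ge0 x) (enorm_ge0 y) dotle => //; apply: widen.
Qed.

Theorem theorem2p19 (K : realType) (n : nat) (rho r R : K)
    (Omega : set 'rV[K]_n)
    (rho_gt0 : 0 < rho) (rho_le_r : rho <= r) (r_le_R : r <= R)
    (Omega_domain : is_domain Omega)
    (Omega_sub : Omega `<=` eball R)
    (sub_Omega : eball r `<=` Omega)
    (Omega_star : star_shaped Omega (eball rho)) :
  (forall x y : 'rV[K]_n,
     lower_const rho r R * enorm (x - y)
       <= enorm (expansion Omega x - expansion Omega y)
     /\
     enorm (expansion Omega x - expansion Omega y)
       <= upper_const rho R * enorm (x - y))
  /\
  [set lower_fun rho a | a in `[r, R]] (lower_const rho r R)
  /\
  (Num.sqrt (3 / 2) * rho <= r ->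
     lower_const rho r R =
       r / (2 * rho) *
         (Num.sqrt (r ^+ 2 + 3 * rho ^+ 2) - Num.sqrt (r ^+ 2 - rho ^+ 2)))
  /\
  (r <= Num.sqrt (3 / 2) * rho <= R ->
     lower_const rho r R = Num.sqrt 3 / 2 * rho)
  /\
  (R <= Num.sqrt (3 / 2) * rho ->
     lower_const rho r R =
       R / (2 * rho) *
         (Num.sqrt (R ^+ 2 + 3 * rho ^+ 2) - Num.sqrt (R ^+ 2 - rho ^+ 2))).
Proof.
split; first by move=> x y; exact: expansion_bounds.
split; first exact: lower_const_attained.
split; first by move=> h; exact: lower_const_right.
split; last by move=> h; exact: lower_const_left.
by move=> h; rewrite lower_const_mid // lower_fun_argmin.
Qed.
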